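(* Let $q$ be a positive power of a prime. For a polynomial $f\in\mathbb{F}_q[X]$ of degree less than $q$ chosen uniformly at random, the expected value of $N_2(f)$ is $q-1$. Moreover, for every $f\in\mathbb{F}_q[X]$, $$\sum_{a\in \mathbb{F}_q} N_2(f(X)+aX) = q(q-1).$$
   Context: $\mathbb{F}_q$ is the finite field of $q$ elements. A polynomial $g\in\mathbb{F}_q[X]$ is regarded as the function $\mathbb{F}_q\to\mathbb{F}_q$, $x\mapsto g(x)$; every function $\mathbb{F}_q\to\mathbb{F}_q$ is represented by a unique polynomial of degree less than $q$. $N_2(g)$ is the number of ordered pairs $(x_1,x_2)\in\mathbb{F}_q\times\mathbb{F}_q$ with $x_1\neq x_2$ and $g(x_1)=g(x_2)$. *)

(* Defs.v *)
From mathcomp Require Import all_boot all_order all_algebra.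

Set Implicit Arguments.
Unset Strict Implicit.
Unset Printing Implicit Defensive.

Import GRing.Theory.
Local Open Scope ring_scope.

Definition N2 (F : finFieldType) (g : {poly F}) : nat :=
  #|[set x : F * F | (x.1 != x.2) && (g.[x.1] == g.[x.2])]|.

(* Expectation of X for the uniform distribution on T, which gives mass
   1 / #|T| to each point.  Only meaningful when T is nonempty. *)
Definition uniform_expectation (T : finType) (X : T -> rat) : rat :=
  \sum_(t : T) #|T|%:R^-1 * X t.

(* Main.v *)
Require Import Defs.
From mathcomp Require Import all_boot all_order all_algebra.

(** Everything rests on one fact: the translates [f + a *: 'X] of a fixed [f],
    with [a] running over the field, separate pairs.  Two distinct points
    [x] and [y] collide under [f + a *: 'X] exactly when [a] is the opposite
    of the slope [(f.[x] - f.[y]) / (x - y)], so each of the [q * (q - 1)]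
    ordered pairs of distinct points is counted for exactly one [a]
    ([sum_N2_addX]).

    The expectation is then an averaging consequence, with no interpolation:
    as [q > 1], adding [a *: 'X] permutes the polynomials of degree less
    than [q], so the total of [N2 f] equals that of [N2 (f + a *: 'X)] for
    every [a].  Summing over [a] as well multiplies the total by [q], while
    the first fact evaluates the double sum as [q * (q - 1)] times the number
    of polynomials ([sum_N2_npoly]). *)

Import GRing.Theory.
Local Open Scope ring_scope.

Lemma sum_distinct_pairs (T : finType) :
  (\sum_(u : T * T | u.1 != u.2) 1 = #|T| * #|T|.-1)%N.
Proof.
rewrite -(pair_big_dep xpredT (fun x y : T => x != y) (fun _ _ => 1%N)) /=.
rewrite (eq_bigr (fun=> #|T|.-1)) ?sum_nat_const // => x _.
by rewrite sum1_card -(cardC1 x); apply: eq_card => y; rewrite !inE eq_sym.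
Qed.

Lemma N2_sum (F : finFieldType) (g : {poly F}) :
  N2 g = (\sum_(u : F * F | u.1 != u.2) (g.[u.1] == g.[u.2]))%N.
Proof.
rewrite /N2 -sum1_card big_mkcond [RHS]big_mkcond /=.
by apply: eq_bigr => u _; rewrite inE; case: (u.1 != u.2); case: eqP.
Qed.

(** Colliding at [x != y] is an affine equation in [a] with leading
    coefficient [x - y], hence has a single solution. *)
Lemma horner_addX_eq (F : fieldType) (f : {poly F}) (x y a : F) : x != y ->
  ((f + a *: 'X).[x] == (f + a *: 'X).[y])
    = (a == - ((f.[x] - f.[y]) / (x - y))).
Proof.
rewrite -subr_eq0 => nz_xy; rewrite !hornerE -subr_eq0.
have ->: f.[x] + a * x - (f.[y] + a * y) = (f.[x] - f.[y]) + a * (x - y).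
  by rewrite opprD addrACA mulrBr.
by rewrite addrC addr_eq0 -mulNr -(can2_eq (mulfK nz_xy) (mulfVK nz_xy)).
Qed.

(** Exchanging the sums counts, for each pair of distinct points, the slopes
    that make it collide; there is exactly one. *)
Lemma sum_N2_addX (F : finFieldType) (f : {poly F}) :
  (\sum_(a : F) N2 (f + a *: 'X) = #|F| * #|F|.-1)%N.
Proof.
under eq_bigr do rewrite N2_sum.
rewrite exchange_big -sum_distinct_pairs /=; apply: eq_bigr => -[x y] /= neq_xy.
under eq_bigr do rewrite horner_addX_eq //.
by rewrite -big_mkcond /= big_pred1_eq.
Qed.

(** Averaging [sum_N2_addX] over [f]: the hypothesis [1 < n] puts ['X] in
    [{poly_n F}], so that each translation by [a *: 'X] is a permutation of
    this space. *)
Lemma sum_N2_npoly (F : finFieldType) (n : nat) : (1 < n)%N ->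
  (\sum_(f : {poly_n F}) N2 (polyn f) = #|{poly_n F}| * #|F|.-1)%N.
Proof.
move=> n_gt1; pose X : {poly_n F} := npolyp n 'X.
have XE : polyn X = 'X by rewrite npolypK ?size_polyX.
have F_gt0 : (0 < #|F|)%N by apply/card_gt0P; exists 0.
have total_translate (a : F) : (\sum_(f : {poly_n F}) N2 (polyn f)
    = \sum_(f : {poly_n F}) N2 (polyn f + a *: 'X))%N.
  rewrite (reindex_inj (addIr (a *: X))) /=.
  by apply: eq_bigr => f _; rewrite -XE.
apply/eqP; rewrite -(eqn_pmul2l F_gt0) -sum_nat_const.
under eq_bigr => a _ do rewrite (total_translate a).
rewrite exchange_big /=; under eq_bigr do rewrite sum_N2_addX.
by rewrite sum_nat_const mulnCA.
Qed.

Theorem lemma3p4 (p n q : nat) (p_prime : prime p) (n_gt0 : (0 < n)%N)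
    (q_def : q = (p ^ n)%N) (F : finFieldType) (cardF : #|F| = q) :
  uniform_expectation (fun f : {poly_q F} => (N2 (polyn f))%:R) = q%:R - 1 /\
  (forall f : {poly F},
     (\sum_(a : F) N2 (f + a *: 'X))%N = (q * (q - 1))%N).
Proof.
have q_gt1 : (1 < q)%N by rewrite -cardF card_finNzRing_gt1.
split=> [|f]; last by rewrite sum_N2_addX cardF subn1.
rewrite /uniform_expectation -mulr_sumr -natr_sum sum_N2_npoly // cardF.
rewrite natrM mulKf; first by rewrite -subn1 natrB // ltnW.
by rewrite Num.Theory.pnatr_eq0 card_npoly cardF expn_eq0 -leqn0 leqNgt ltnW.
Qed.
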